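(* Suppose (A1) $f(x)\to+\infty$ as $|x|\to\infty$; (A2) $\nabla f\neq 0$ on $\Omega$; (A3) $\nabla g\neq 0$ on $\Omega$; (A4) $f$ and $g$ are twice continuously differentiable. Let the origin be a point of the central path $L$ that is relative convex. Fix an initial point $(\tilde x_0,x_n^0)$ with $x_n^0>0$. Then, as $\zeta\to1^-$, the solution of the linearized system $$\frac{dx_i}{dt}=-\lambda_ix_i+\lambda_il_ix_n+(1-\zeta)\Big(\sum_{j=1}^{n-1}a_{ij}x_j+b_ix_n\Big)\ (1\le i\le n-1),\qquad \frac{dx_n}{dt}=-(1-\zeta)$$ starting at $(\tilde x_0,x_n^0)$ converges to the tangent line $\{x_i=l_ix_n,\ 1\le i\le n-1\}$ of the central path at the origin, in the following sense: writing the solution as a curve $\tilde x=\tilde x_\zeta(x_n)$ parametrized by $x_n$ (possible since $x_n$ is strictly decreasing in $t$), for every $x_n<x_n^0$ one has $\tilde x_\zeta(x_n)\to(l_1x_n,\dots,l_{n-1}x_n)$ as $\zeta\to1^-$.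
   Context: Let $f,g:\mathbb{R}^n\to\mathbb{R}$, $\Omega=\{x: g(x)\le0\}$, and let $|\cdot|$ be the Euclidean norm. The central path is $L=\{x\in\Omega:\frac{\nabla f}{|\nabla f|}+\frac{\nabla g}{|\nabla g|}=0\}$. Given a point of $L$, use orthonormal coordinates $(\tilde x,x_n)$, $\tilde x=(x_1,\dots,x_{n-1})$, with this point as origin and with the $x_n$-axis in the direction $\frac{\nabla f}{|\nabla f|}$ at the origin. Let $$\tilde C=\frac1{|\nabla f|}\nabla^2_{\tilde x}f(\mathbf 0)+\frac1{|\nabla g|}\nabla^2_{\tilde x}g(\mathbf 0),$$ where $\nabla^2_{\tilde x}$ is the $(n-1)\times(n-1)$ Hessian in the variables $\tilde x$. The point is called nondegenerate if $\tilde C$ is invertible and relative convex if $\tilde C$ is positive definite. The coordinates $\tilde x$ are chosen along orthonormal eigenvectors of $\tilde C$, so that $\tilde C$ becomes the diagonal matrix $\tilde C_\lambda=\mathrm{diag}(\lambda_1,\dots,\lambda_{n-1})$. All at the origin, set $a_{ij}=\frac{\partial_{x_i}\partial_{x_j}g}{|\nabla g|}$ and $b_i=\partial_{x_n}\big(\frac{\partial_{x_i}g}{|\nabla g|}\big)$ for $1\le i,j\le n-1$, $\mu_i=\partial_{x_n}\big(\frac{\partial_{x_i}f}{|\nabla f|}\big)+\partial_{x_n}\big(\frac{\partial_{x_i}g}{|\nabla g|}\big)$, and let $l_i$ be determined by $\lambda_il_i+\mu_i=0$; the line $x_i=l_ix_n$ ($1\le i\le n-1$) is the tangent of $L$ at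 the origin. *)

(* Defs.v *)
From mathcomp Require Export all_boot all_order all_algebra.
From mathcomp Require Export all_classical all_reals all_analysis.
Export Order.TTheory GRing.Theory Num.Theory.
Export numFieldNormedType.Exports.

Set Implicit Arguments.
Unset Strict Implicit.
Unset Printing Implicit Defensive.

Local Open Scope classical_set_scope.
Local Open Scope ring_scope.

Section Calculus.
Context {R : realType} {n : nat}.
Implicit Types (v x : 'rV[R]_n) (h : 'rV[R]_n -> R).

(* The norm provided by the library on ['rV[R]_n] is the sup norm. *)
Definition enorm v : R := Num.sqrt (\sum_i v 0 i ^+ 2).

Definition partial (i : 'I_n) h x : R := 'D_(delta_mx 0 i) h x.

Definition grad h x : 'rV[R]_n := \row_i partial i h x.

(* Equal to 0 where the gradient vanishes. *)
Definition unit_grad h x : 'rV[R]_n := (enorm (grad h x))^-1 *: grad h x.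

Definition C1 h : Prop :=
  forall i, (forall x, derivable h x (delta_mx 0 i)) /\ continuous (partial i h).

Definition C2 h : Prop := C1 h /\ forall i, C1 (partial i h).

Definition tends_to_pinfty h : Prop :=
  forall M : R, exists r : R, forall x, r < enorm x -> M < h x.

Definition central_path (f g : 'rV[R]_n -> R) : set 'rV[R]_n :=
  [set x | g x <= 0 /\ unit_grad f x + unit_grad g x = 0].

Definition positive_definite (A : 'M[R]_n) : Prop :=
  A^T = A /\ forall v, v != 0 -> 0 < (v *m A *m v^T) 0 0.

End Calculus.

(* The ambient dimension is [m.+1]. The coordinate [x_n] has index [ord_max],
   the coordinates [\tilde x] have the indices [tilde i], [i : 'I_m]. *)
Section Coordinates.
Context {R : realType} {m : nat}.
Implicit Types (F G : 'rV[R]_m.+1 -> R) (p : 'rV[R]_m.+1) (Q : 'M[R]_m.+1).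

Definition tilde (i : 'I_m) : 'I_m.+1 := lift ord_max i.

(* The rows of [Q] are the new orthonormal axes. *)
Definition adapted_frame (f : 'rV[R]_m.+1 -> R) p Q : Prop :=
  Q *m Q^T = 1%:M /\ row ord_max Q = unit_grad f p.

Definition in_frame p Q (h : 'rV[R]_m.+1 -> R) : 'rV[R]_m.+1 -> R :=
  fun y => h (p + y *m Q).

(* Below, [F] and [G] are the two functions written in the new coordinates. *)

Definition scaled_hessian F : 'M[R]_m :=
  \matrix_(i, j) (partial (tilde i) (partial (tilde j) F) 0 / enorm (grad F 0)).

Definition Ctilde F G : 'M[R]_m := scaled_hessian F + scaled_hessian G.

Definition normal_coef F : 'rV[R]_m :=
  \row_i partial ord_max (fun y => unit_grad F y 0 (tilde i)) 0.

Definition relative_convex F G : Prop := positive_definite (Ctilde F G).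

End Coordinates.

Section LinearizedSystem.
Context {R : realType} {m : nat}.
Variables (lam l b : 'rV[R]_m) (a : 'M[R]_m) (x0 : 'rV[R]_m) (xn0 : R).

Definition solution (zeta : R) (x : R -> 'rV[R]_m) (xn : R -> R) : Prop :=
  [/\ x 0 = x0 /\ x t @[t --> 0^'+] --> x0,
      xn 0 = xn0 /\ xn t @[t --> 0^'+] --> xn0,
      forall (i : 'I_m) (t : R), 0 < t ->
        is_derive t 1 (fun s => x s 0 i)
          (- lam 0 i * x t 0 i + lam 0 i * l 0 i * xn t
           + (1 - zeta) * (\sum_j a i j * x t 0 j + b 0 i * xn t)) &
      forall t : R, 0 < t -> is_derive t 1 xn (- (1 - zeta))].

(* [c] is a solution for [t >= 0], parametrized by [x_n]; only the values of [c]
   on [`]-oo, xn0]] matter. *)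
Definition solution_curve (zeta : R) (c : R -> 'rV[R]_m) : Prop :=
  exists (x : R -> 'rV[R]_m) (xn : R -> R),
    solution zeta x xn /\ forall t, 0 <= t -> c (xn t) = x t.

End LinearizedSystem.

(* Main.v *)
Require Import Defs.
From mathcomp Require Import ring lra.

(** The linearized system has constant coefficients, and relative convexity
    makes every [lam 0 i] positive, so that for [zeta = 1], where [xn] is
    constant, [x] converges exponentially to [xn *: l], a point of the tangent
    line.

    Existence. After adjoining [xn] and the constant function 1 as extra
    unknowns, the system is homogeneous, [y' = A y]. Its solution
    [exp (t A) y0] is built as a power series, coordinate by coordinate
    ([linear_ode_exists]). As [xn t = xn0 - (1 - zeta) * t] is injective in
    [t], the solution is a curve parametrized by [xn].

    Convergence. Put [eps = 1 - zeta] and let [e i = x i - l i * xn] be the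
    deviation from the tangent line. Then
    [[
      e i' = - lam i * e i + eps * (\sum_j a i j * e j + d i),
    ]]
    where [d] stays bounded, uniformly in [eps], while [xn] runs from [xn0]
    down to the prescribed value. The linear part contracts at the rate
    [k = min (1, min_i lam i)], independently of [eps], so the energy
    [E = \sum_i e i ^ 2] satisfies [E' <= - k E + O(eps)] for small [eps]
    ([dissipation_estimate]); hence [E t <= O(eps) + exp (- k t) E 0]
    ([exponential_decay]). The value [xn] is reached at the time
    [t = (xn0 - xn) / eps], which tends to infinity, so the transient
    [exp (- k t) <= 1 / (k t)] is [O(eps)] too. Altogether the squared distance
    to the tangent line at height [xn] is [O(1 - zeta)]
    ([dist_tangent_bound]). *)

Local Open Scope classical_set_scope.
Local Open Scope ring_scope.

(** * Linear systems with constant coefficients *)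

Section Egf.
Context {R : realType}.
Implicit Types (u : nat -> R) (C N t : R).

(** The exponential generating function of [u]. Differentiation acts on it as
    the shift of [u], so a linear recurrence for [u] becomes a linear
    differential equation. *)
Definition egf u t : R := limn (pseries (fun k => u k / k`!%:R) t).

Definition geometric_growth u :=
  exists C N : R, forall k, `|u k| <= N * C ^+ k.

Lemma geometric_growthS {u} :
  geometric_growth u -> geometric_growth (fun k => u k.+1).
Proof.
by move=> [C [N uCN]]; exists C, (N * C) => k; rewrite -mulrA -exprS.
Qed.

Lemma is_cvg_egf {u t} : geometric_growth u ->
  cvgn (pseries (fun k => u k / k`!%:R) t).
Proof.
move=> [C [N uCN]]; apply: normed_cvg.
(* The exponential series of [C * `|t|], scaled by [N], dominates. *)
have dom k : `|u k / k`!%:R * t ^+ k| <= (N *: exp_coeff (C * `|t|)) k.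
  rewrite /= fctE /exp_coeff /= !normrM normfV normr_nat exprMn normrX.
  rewrite /GRing.scale /= mulrAC !mulrA.
  by rewrite ler_wpM2r ?invr_ge0 ?ler0n// ler_wpM2r.
apply: (@series_le_cvg _ _ (N *: exp_coeff (C * `|t|))) => //.
- by move=> k; exact: normr_ge0.
- by move=> k; exact: le_trans (normr_ge0 _) (dom k).
- by apply: is_cvg_seriesZ; exact: is_cvg_series_exp_coeff.
Qed.

Lemma pseries_diffs_egf u :
  pseries_diffs (fun k => u k / k`!%:R) = (fun k => u k.+1 / k`!%:R).
Proof.
apply/funext => k; rewrite /pseries_diffs factS natrM.
by rewrite invfM mulrCA mulVKf ?pnatr_eq0.
Qed.

Lemma is_derive_egf u t : geometric_growth u ->
  is_derive t 1 (egf u) (egf (fun k => u k.+1) t).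
Proof.
move=> gu; have gu1 := geometric_growthS gu.
rewrite /egf -pseries_diffs_egf.
apply: (@pseries_snd_diffs _ _ (`|t| + 1)).
- exact: is_cvg_egf.
- by rewrite pseries_diffs_egf; exact: is_cvg_egf.
- rewrite pseries_diffs_egf (pseries_diffs_egf (fun k => u k.+1)).
  exact: (@is_cvg_egf (fun k => u k.+2) _ (geometric_growthS gu1)).
- by rewrite [ltRHS]ger0_norm ?addr_ge0// ltrDl.
Qed.

Lemma egf0 u : egf u 0 = u 0%N.
Proof.
apply/cvg_lim => //; apply/cvg_ballP => e e0; near=> n.
rewrite /pseries /series /=.
have -> : n = n.-1.+1 by rewrite prednK//; near: n; exists 1%N.
rewrite big_nat_recl// expr0 fact0 divr1 mulr1 big1 ?addr0; last first.
  by move=> k _; rewrite exprS mul0r mulr0.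
exact: ballxx.
Unshelve. all: by end_near. Qed.

Lemma egf_lincomb (I : finType) (a : I -> R) (v : I -> nat -> R) t :
  (forall j, geometric_growth (v j)) ->
  egf (fun k => \sum_j a j * v j k) t = \sum_j a j * egf (v j) t.
Proof.
move=> gv; apply/cvg_lim => //.
rewrite [X in X @ _ --> _](_ : _ = (fun n => \sum_j
    a j * pseries (fun k => v j k / k`!%:R) t n)).
  apply: cvg_big => [|j _]; first exact: add_continuous.
  by apply: cvgMr; exact: is_cvg_egf.
apply/funext => n; rewrite /pseries /series /=.
under [RHS]eq_bigr do rewrite mulr_sumr.
rewrite [RHS]exchange_big; apply: eq_bigr => k _ /=.
by rewrite !mulr_suml; apply: eq_bigr => j _; rewrite !mulrA.
Qed.

(** The [k]-th derivative at 0 of a solution of [y' = A y] must be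
    [v k = A ^ k y0], which grows at most geometrically; the solution is the
    exponential generating function of [v]. *)
Lemma linear_ode_exists (I : finType) (A : I -> I -> R) (y0 : I -> R) :
  exists y : I -> R -> R, (forall i, y i 0 = y0 i) /\
    forall i t, is_derive t 1 (y i) (\sum_j A i j * y j t).
Proof.
pose v i k := iter k (fun w i => \sum_j A i j * w j) y0 i.
have gv i : geometric_growth (v i).
  exists (\sum_i \sum_j `|A i j|), (\sum_i `|y0 i|) => k.
  elim: k i => [|k IH] i.
    by rewrite mulr1 (bigD1 i)//= lerDl sumr_ge0.
  rewrite /v iterS (le_trans (ler_norm_sum _ _ _))//.
  have Ai : \sum_j `|A i j| <= \sum_i \sum_j `|A i j|.
    by rewrite [leRHS](bigD1 i)//= lerDl sumr_ge0// => ? _; exact: sumr_ge0.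
  rewrite exprS mulrCA (le_trans _ (ler_wpM2r _ Ai))//; last first.
    exact: le_trans (IH i).
  rewrite mulr_suml ler_sum// => j _.
  by rewrite normrM ler_wpM2l// IH.
exists (fun i => egf (v i)); split => [i|i t]; first exact: egf0.
have -> : \sum_j A i j * egf (v j) t = egf (fun k => v i k.+1) t.
  by rewrite -egf_lincomb.
exact: is_derive_egf.
Qed.

End Egf.

(** * Differential inequalities *)

Section Decay.
Context {R : realType}.

(** Continuity at 0 is one-sided because solutions of the linearized system
    are unconstrained at negative times. *)
Lemma le_of_derive_le0 (f df : R -> R) (t : R) : 0 <= t ->
  f s @[s --> 0^'+] --> f 0 ->
  (forall s, 0 < s <= t -> is_derive s 1 f (df s) /\ df s <= 0) ->
  f t <= f 0.
Proof.
rewrite le_eqVlt => /predU1P[<-//|t0] f0 fdf.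
have dfs s : 0 < s <= t -> derivable f s 1.
  by move=> /fdf[df' _]; exact: ex_derive.
have cf s : 0 < s <= t -> {for s, continuous f}.
  by move=> /dfs ?; apply: differentiable_continuous; exact/derivable1_diffP.
have itv s : s \in `]0, t[ -> 0 < s <= t.
  by rewrite in_itv/= => /andP[-> /ltW].
apply: (@ler0_derive1_nincr _ f 0 t) => //; last exact: ltW.
- by move=> s /itv; exact: dfs.
- by move=> s /itv /fdf[df' ?]; rewrite derive1E derive_val.
- apply/continuous_within_itvP => //; split => // [s|].
    by move=> /itv; exact: cf.
  by apply: cvg_at_left_filter; apply: cf; rewrite t0 lexx.
Qed.

(** Gronwall's inequality for [E' <= - k E + c]: with the integrating factor
    [exp (k s)], the quantity [exp (k s) * (E s - c / k)] is nonincreasing. *)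
Lemma exponential_decay (E dE : R -> R) (k c t : R) : 0 < k -> 0 <= t ->
  E s @[s --> 0^'+] --> E 0 ->
  (forall s, 0 < s <= t -> is_derive s 1 E (dE s) /\ dE s <= - k * E s + c) ->
  E t <= c / k + expR (- (k * t)) * (E 0 - c / k).
Proof.
move=> k0 t0 E0 HE.
pose W s := expR (k * s) * (E s - c / k).
have : W t <= W 0.
  apply: (@le_of_derive_le0 _
    (fun s => expR (k * s) * (k * (E s - c / k) + dE s))) => //.
    rewrite /W; apply: cvgM; last by apply: cvgB => //; exact: cvg_cst.
    apply: cvg_at_right_filter; apply: continuous_comp.
      by apply: cvgMr; exact: cvg_id.
    exact: continuous_expR.
  move=> s /HE[dEs Es]; split.
    have dexp : is_derive s 1 (expR \o *%R k) (expR (k * s) * k).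
      apply: is_derive1_comp; apply: is_derive_eq.
      by rewrite /GRing.scale /= mulr1.
    have := @is_deriveM _ _ _ (E - cst (c / k)) _ _ _ _ dexp _.
    move/(_ (dE s - 0)) => dW.
    apply: is_derive_eq (dW _) _.
    rewrite /GRing.scale /= (_ : (E - _) s = E s - c / k)//; ring.
  apply: mulr_ge0_le0; first exact: expR_ge0.
  by rewrite mulrBr mulrCA divff ?gt_eqF//; lra.
rewrite /W mulr0 expR0 mul1r mulrC -ler_pdivlMr ?expR_gt0// -expRN.
lra.
Qed.

(** Bounds the derivative of the energy [\sum_i e i ^+ 2]: the terms with [a]
    and [d] are absorbed through [2 y z <= y ^ 2 + z ^ 2], at the price of a
    loss of order [eps] in the contraction rate. *)
Lemma dissipation_estimate (m : nat) (lam d e : 'I_m -> R)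
    (a : 'I_m -> 'I_m -> R) (k eps D : R) :
  0 <= eps -> (forall i, k <= lam i) -> (forall i, `|d i| <= D) ->
  \sum_i 2 * e i * (- lam i * e i + eps * (\sum_j a i j * e j + d i)) <=
  - (2 * k - eps * (2 * (\sum_i \sum_j `|a i j|) + 1)) * (\sum_i e i ^+ 2)
    + eps * (m%:R * D ^+ 2).
Proof.
move=> eps0 klam dD; set S := \sum_i e i ^+ 2.
have eS i : e i ^+ 2 <= S.
  by rewrite /S (bigD1 i)//= lerDl sumr_ge0// => j _; exact: sqr_ge0.
have cross i j : 2 * e i * (a i j * e j) <= `|a i j| * (2 * S).
  rewrite (le_trans (ler_norm _))// !normrM (ger0_norm (ler0n _ 2)).
  have := eS i; have := eS j.
  rewrite -(real_normK (num_real (e i))) -(real_normK (num_real (e j))).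
  have := normr_ge0 (a i j); move: `|a i j| `|e i| `|e j| => x y z x0 zS yS.
  rewrite [leLHS](_ : _ = x * (2 * y * z)); last by ring.
  rewrite ler_wpM2l//; have := sqr_ge0 (y - z); nra.
have drift i : 2 * e i * d i <= e i ^+ 2 + D ^+ 2.
  have dD2 : d i ^+ 2 <= D ^+ 2.
    rewrite -(real_normK (num_real (d i))).
    by rewrite ler_pXn2r ?nnegrE ?(le_trans _ (dD i)).
  have := sqr_ge0 (e i - d i); nra.
have -> : - (2 * k - eps * (2 * (\sum_i \sum_j `|a i j|) + 1)) * S
    + eps * (m%:R * D ^+ 2) = \sum_i (- (2 * k) * e i ^+ 2
    + eps * (\sum_j (`|a i j| * (2 * S)) + (e i ^+ 2 + D ^+ 2))).
  rewrite big_split/= -!mulr_sumr !big_split/= -/S sumr_const card_ord.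
  rewrite -[_ *+ m]mulr_natl.
  have -> : \sum_i \sum_j `|a i j| * (2 * S) =
      (\sum_i \sum_j `|a i j|) * (2 * S).
    by rewrite mulr_suml; apply: eq_bigr => i _; rewrite mulr_suml.
  ring.
apply: ler_sum => i _.
rewrite mulrDr lerD//.
  have := klam i; have := sqr_ge0 (e i); nra.
by rewrite mulrCA ler_wpM2l// mulrDr lerD// mulr_sumr ler_sum.
Qed.

End Decay.

(** * The linearized system *)

Section Linearized.
Context {R : realType} {m : nat}.
Implicit Types (lam l b : 'rV[R]_m) (a : 'M[R]_m) (zeta : R).

Lemma positive_definite_diag lam :
  positive_definite (diag_mx lam) -> forall i, 0 < lam 0 i.
Proof.
move=> [_ pos] i.
have /pos : delta_mx 0 i != 0 :> 'rV[R]_m.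
  apply/eqP => /rowP/(_ i); rewrite !mxE !eqxx => /eqP.
  by rewrite oner_eq0.
rewrite -rowE mxE (bigD1 i)//= !mxE !eqxx mulr1n mulr1 big1 ?addr0// => j ji.
by rewrite !mxE eq_sym (negbTE ji) mulr0n mul0r.
Qed.

(** Apply monotonicity to [h s = xn s + (1 - zeta) * s] and to [- h], both of
    derivative 0. *)
Lemma xn_affine {lam l b a x0 xn0 zeta x xn} :
  solution lam l b a x0 xn0 zeta x xn ->
  forall t, 0 <= t -> xn t = xn0 - (1 - zeta) * t.
Proof.
move=> [_ [xn00 xn0c] _ dxn] t t0.
pose h s := xn s + (1 - zeta) * s.
have hc : h s @[s --> 0^'+] --> h 0.
  rewrite /h xn00; apply: cvgD => //; apply: cvg_at_right_filter.
  by apply: cvgMr; exact: cvg_id.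
have dh (s : R) : 0 < s -> is_derive s 1 h 0.
  move=> s0; have := dxn s s0 => dxns.
  have dl : is_derive s 1 ( *%R (1 - zeta)) (1 - zeta).
    by apply: is_derive_eq; rewrite /GRing.scale /= mulr1.
  by apply: is_derive_eq (is_deriveD dxns dl) _; rewrite addNr.
have le1 : h t <= h 0.
  by apply: (le_of_derive_le0 h (cst 0)) => // s /andP[s0 _]; split => //;
    exact: dh.
have le2 : - h t <= - h 0.
  apply: (le_of_derive_le0 (- h) (cst 0)) => //; first exact: cvgN.
  move=> s /andP[s0 _]; split => //.
  by apply: is_derive_eq (is_deriveN (dh s s0)) _; rewrite oppr0.
have : h t = h 0 by apply/le_anti; rewrite le1 -lerN2 le2.
by rewrite /h xn00 mulr0 addr0 => <-; rewrite addrK.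
Qed.

Lemma solution_curve_exists lam l b a x0 xn0 zeta : zeta < 1 ->
  exists c, solution_curve lam l b a x0 xn0 zeta c.
Proof.
move=> z1; set eps := 1 - zeta.
have eps0 : 0 < eps by rewrite subr_gt0.
(* [inr true] is the index of [xn], [inr false] that of the constant 1. *)
pose A (p q : 'I_m + bool) := match p, q with
  | inl i, inl j => - (lam 0 i *+ (i == j)) + eps * a i j
  | inl i, inr true => lam 0 i * l 0 i + eps * b 0 i
  | inr true, inr false => - eps
  | _, _ => 0
  end.
pose y0 (p : 'I_m + bool) := match p with
  | inl i => x0 0 i | inr true => xn0 | inr false => 1 end.
have [y [yE dy]] := linear_ode_exists _ A y0.
have yc p : y p t @[t --> 0^'+] --> y p 0.
  apply: cvg_at_right_filter.
  apply: differentiable_continuous; apply/derivable1_diffP.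
  exact: (@ex_derive _ _ _ _ _ _ _ (dy p 0)).
have y1 t : y (inr false) t = 1.
  rewrite -[1]/(y0 (inr false)) -yE; apply: is_derive_0_is_cst => s.
  by apply: is_derive_eq (dy _ s) _; rewrite big1// => j _; rewrite mul0r.
have sol : solution lam l b a x0 xn0 zeta
    (fun t => \row_i y (inl i) t) (y (inr true)).
  split.
  - split; first by apply/rowP => i; rewrite mxE yE.
    apply/cvg_ballP => e e0.
    have near_i i : \forall t \near 0^'+, ball (x0 0 i) e (y (inl i) t).
      have /cvg_ballP := yc (inl i); rewrite yE; exact.
    apply: filterS; last exact: (filter_forall _ near_i).
    by move=> t xt; split => // i j; rewrite mxE ord1; exact: xt.
  - by rewrite -[X in _ --> X](yE (inr true)).
  - move=> i t t0; under eq_fun do rewrite mxE.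
    apply: is_derive_eq (dy _ t) _.
    rewrite big_sumType big_bool /= mul0r addr0 mxE.
    under eq_bigr do rewrite mulrDl.
    rewrite big_split/= (bigD1 i)//= eqxx mulr1n big1 ?addr0; last first.
      by move=> j ji; rewrite eq_sym (negbTE ji) mulr0n oppr0 mul0r.
    under [in RHS]eq_bigr do rewrite mxE.
    rewrite [in RHS]mulrDr mulr_sumr.
    under eq_bigr do rewrite -mulrA.
    by rewrite /eps; ring.
  - move=> t t0; apply: is_derive_eq (dy _ t) _.
    rewrite big_sumType big_bool /= y1 mul0r mulr1 add0r big1 ?add0r// => j _.
    by rewrite mul0r.
exists (fun s => \row_i y (inl i) ((xn0 - s) / eps)).
eexists _, _; split; first exact: sol.
by move=> t t0; rewrite (xn_affine sol)// subKr mulrC mulKf ?gt_eqF.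
Qed.

(** The curve reaches height [xn] only after the time [(xn0 - xn) / (1 - zeta)],
    long enough for the initial deviation to be damped to order [1 - zeta], the
    size of the perturbation itself. *)
Lemma dist_tangent_bound lam l b a x0 xn0 xn :
  (forall i, 0 < lam 0 i) -> xn < xn0 ->
  exists K delta : R, 0 < delta /\ forall zeta c, 1 - delta < zeta < 1 ->
    solution_curve lam l b a x0 xn0 zeta c ->
    \sum_i (c xn 0 i - l 0 i * xn) ^+ 2 <= (1 - zeta) * K.
Proof.
move=> lam0 xnlt.
(* The default 1 keeps [k] positive when [m = 0]. *)
pose k := \big[Num.min/1]_i lam 0 i.
have k0 : 0 < k by apply/bigmin_gtP; split.
have klam i : k <= lam 0 i by exact: bigmin_le.
(* [delta = k / al] is chosen so that, of the contraction rate [2 * k], the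
   perturbation removes at most [k]. *)
pose al := 2 * (\sum_i \sum_j `|a i j|) + 1.
have al0 : 0 < al.
  by rewrite ltr_wpDl// mulr_ge0// sumr_ge0// => i _; exact: sumr_ge0.
(* [X] bounds [xn] along the run, and [D] the forcing [d] below. *)
pose X := `|xn0| + `|xn|.
pose D := \sum_i (X * `|\sum_j a i j * l 0 j + b 0 i| + `|l 0 i|).
pose E0 := \sum_i (x0 0 i - l 0 i * xn0) ^+ 2.
exists (m%:R * D ^+ 2 / k + E0 / (k * (xn0 - xn))), (k / al).
split; first exact: divr_gt0.
move=> zeta c /andP[zlt z1] [x [xnf [sol cx]]].
have xnE := xn_affine sol.
have [[x00 xc] [xn00 xnc] dx dxn] := sol.
set eps := 1 - zeta; have eps0 : 0 < eps by rewrite subr_gt0.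
have epsk : eps * al <= k.
  by rewrite -ler_pdivlMr//; apply: ltW; rewrite /eps; lra.
pose t := (xn0 - xn) / eps.
have t0 : 0 < t by rewrite divr_gt0// subr_gt0.
have xnt : xnf t = xn.
  by rewrite xnE ?ltW// /t mulrCA divff ?gt_eqF// mulr1 subKr.
rewrite -{1 2}xnt (cx _ (ltW t0)).
pose e i s := x s 0 i - l 0 i * xnf s.
pose d i s := (\sum_j a i j * l 0 j + b 0 i) * xnf s + l 0 i.
pose de i s := - lam 0 i * e i s + eps * (\sum_j a i j * e j s + d i s).
have dE i (s : R) : 0 < s -> is_derive s 1 (e i) (de i s).
  move=> s0; have dxs := dx i s s0; have dxns := dxn s s0.
  have dl := is_deriveM (is_derive_cst (l 0 i) s 1) dxns.
  apply: is_derive_eq (is_deriveB dxs dl) _.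
  rewrite /de /d /e /GRing.scale /= /cst.
  under [in RHS]eq_bigr do rewrite mulrBr mulrA.
  rewrite sumrB -mulr_suml -/eps; ring.
have decay := exponential_decay (fun s => \sum_i e i s ^+ 2)
  (fun s => \sum_i 2 * e i s * de i s) k (eps * (m%:R * D ^+ 2)) t k0 (ltW t0).
have {decay} : \sum_i e i t ^+ 2 <= eps * (m%:R * D ^+ 2) / k
    + expR (- (k * t)) * (\sum_i e i 0 ^+ 2 - eps * (m%:R * D ^+ 2) / k).
  apply: decay.
    apply: cvg_big => [|i _]; first exact: add_continuous.
    have ec : e i s @[s --> 0^'+] --> e i 0.
      apply: cvgB; last by apply: cvgMr; rewrite xn00.
      rewrite x00.
      have cc : continuous (fun M : 'rV[R]_m => M 0 i) by exact: coord_continuous.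
      exact: (continuous_cvg _ (cc x0) xc).
    by under eq_fun do rewrite expr2; rewrite expr2; exact: cvgM.
  move=> s /andP[s0 st]; split.
    rewrite (_ : (fun _ => _) = \sum_i (e i ^+ 2)); last first.
      by apply/funext => u; rewrite fct_sumE.
    apply: is_derive_eq; first apply: is_derive_sum => i.
      by have := dE i s s0; move=> des; exact: is_deriveX.
    by apply: eq_bigr => i _; rewrite /GRing.scale /=; ring.
  have dD i : `|d i s| <= D.
    rewrite /D (bigD1 i)//= ler_wpDr//.
      by apply: sumr_ge0 => j _; rewrite addr_ge0 ?mulr_ge0 ?addr_ge0.
    rewrite (le_trans (ler_normD _ _))// lerD2r normrM mulrC ler_wpM2r//.
    have : xn <= xnf s <= xn0.
      rewrite -xnt (xnE _ (ltW t0)) (xnE _ (ltW s0)).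
      by rewrite lerD2l lerN2 ler_wpM2l ?(ltW eps0)//= gerBl mulr_ge0 ?ltW.
    rewrite /X ler_norml => /andP[? ?].
    have := ler_norm xn0; have := ler_norm xn.
    have := ler_norm (- xn0); have := ler_norm (- xn); rewrite !normrN.
    have := normr_ge0 xn0; have := normr_ge0 xn; lra.
  apply: le_trans (dissipation_estimate _ _ _ _ _ _ eps _ (ltW eps0) klam dD) _.
  rewrite lerD2r -/al ler_wpM2r ?sumr_ge0// => [i _|]; first exact: sqr_ge0.
  lra.
move=> decay; apply: le_trans decay _.
have -> : \sum_i e i 0 ^+ 2 = E0.
  by apply: eq_bigr => i _; rewrite /e x00 xn00.
have E00 : 0 <= E0 by apply: sumr_ge0 => i _; exact: sqr_ge0.
have M0 : 0 <= eps * (m%:R * D ^+ 2) / k.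
  by rewrite divr_ge0 ?(ltW k0)// mulr_ge0 ?(ltW eps0)// mulr_ge0 ?sqr_ge0.
rewrite [leRHS]mulrDr [X in _ <= X + _]mulrA lerD2l.
apply: (@le_trans _ _ (expR (- (k * t)) * E0)).
  by rewrite ler_wpM2l ?expR_ge0// gerBl.
rewrite [leLHS]mulrC [leRHS]mulrCA ler_wpM2l//.
rewrite (_ : eps / _ = (k * t)^-1); last first.
  by rewrite /t mulrA [RHS]invfM invrK mulrC.
(* [k * t <= exp (k * t)] turns the exponential decay into a factor [eps]. *)
rewrite expRN lef_pV2 ?posrE ?expR_gt0 ?(mulr_gt0 k0 t0)//.
by apply: le_trans (expR_ge1Dx _); rewrite lerDr.
Qed.

End Linearized.

Theorem theorem7 (R : realType) (m : nat) (f g : 'rV[R]_m.+1 -> R)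
  (A1 : tends_to_pinfty f)
  (A2 : forall x, g x <= 0 -> grad f x != 0)
  (A3 : forall x, g x <= 0 -> grad g x != 0)
  (A4 : C2 f /\ C2 g)
  (p : 'rV[R]_m.+1) (Q : 'M[R]_m.+1)
  (pL : central_path f g p)
  (frameQ : adapted_frame f p Q)
  (F : 'rV[R]_m.+1 -> R) (FE : F = in_frame p Q f)
  (G : 'rV[R]_m.+1 -> R) (GE : G = in_frame p Q g)
  (convex0 : relative_convex F G)
  (lam : 'rV[R]_m) (lamE : Ctilde F G = diag_mx lam)
  (a : 'M[R]_m) (aE : a = scaled_hessian G)
  (b : 'rV[R]_m) (bE : b = normal_coef G)
  (mu : 'rV[R]_m) (muE : mu = normal_coef F + normal_coef G)
  (l : 'rV[R]_m) (lE : forall i, lam 0 i * l 0 i + mu 0 i = 0)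
  (x0 : 'rV[R]_m) (xn0 : R) (xn0_gt0 : 0 < xn0) :
  (forall zeta : R, zeta < 1 ->
     exists c : R -> 'rV[R]_m, solution_curve lam l b a x0 xn0 zeta c) /\
  (forall xs : R -> R -> 'rV[R]_m,
     (\forall zeta \near 1^'-, solution_curve lam l b a x0 xn0 zeta (xs zeta)) ->
     forall xn : R, xn < xn0 -> xs zeta xn @[zeta --> 1^'-] --> xn *: l).
Proof.
split=> [zeta|xs xsP xn xnlt]; first exact: solution_curve_exists.
have lam0 : forall i, 0 < lam 0 i.
  by apply: positive_definite_diag; rewrite -lamE.
have [K [delta [delta0 HK]]] := dist_tangent_bound _ l b a x0 _ _ lam0 xnlt.
have K1 : 0 < `|K| + 1 by rewrite ltr_wpDl.
(* Balls of row vectors are those of the sup norm, so each coordinate is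
   bounded by the Euclidean distance. *)
apply/cvg_ballP => e e0; near=> zeta; split => // j i; rewrite ord1 {j} !mxE.
have z1 : 0 < 1 - zeta by rewrite subr_gt0; near: zeta; exact: nbhs_left_lt.
have : \sum_i (xs zeta xn 0 i - l 0 i * xn) ^+ 2 <= (1 - zeta) * K.
  apply: HK; last by near: zeta.
  apply/andP; split; last by rewrite -subr_gt0.
  by near: zeta; apply: nbhs_left_gt; rewrite gtrBl.
have : (1 - zeta) * (`|K| + 1) < e ^+ 2.
  rewrite -ltr_pdivlMr//; near: zeta; apply: nbhs_left_ltBl.
  by rewrite divr_gt0// exprn_gt0.
have : (1 - zeta) * K <= (1 - zeta) * (`|K| + 1).
  by rewrite ler_wpM2l ?(ltW z1)// (le_trans (ler_norm K))// lerDl.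
rewrite (bigD1 i)//=.
have : 0 <= \sum_(j | j != i) (xs zeta xn 0 j - l 0 j * xn) ^+ 2.
  by apply: sumr_ge0 => j _; exact: sqr_ge0.
move: (\sum_(j | _) _) => S S0 h1 h2 h3.
rewrite /ball /= distrC mulrC -ltr_sqr ?nnegrE ?(ltW e0)// real_normK ?num_real//.
lra.
Unshelve. all: by end_near. Qed.
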